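(* Let $\Omega$ be an additive semigroup and $\mathbb{K}$ a commutative ring. The set of moulds on $\Omega$ with values in $\mathbb{K}$, equipped with the operations $(+,\times,\circ)$, is a composition algebra: for all moulds $M^\bullet,N^\bullet,A^\bullet$, $$(M^\bullet+N^\bullet)\circ A^\bullet=(M^\bullet\circ A^\bullet)+(N^\bullet\circ A^\bullet),\qquad (M^\bullet\times N^\bullet)\circ A^\bullet=(M^\bullet\circ A^\bullet)\times(N^\bullet\circ A^\bullet).$$
   Context: $\Omega^*$ is the set of finite sequences (words) on $\Omega$, including the empty word $\emptyset$. A mould on $\Omega$ is a map $M^\bullet:\Omega^*\to\mathbb{K}$, $\underline{\omega}\mapsto M^{\underline{\omega}}$. For $\underline{\omega}=\omega_1\dots\omega_r$ non-empty, $\|\underline{\omega}\|=\omega_1+\dots+\omega_r\in\Omega$. The operations are: $(M+N)^{\underline{\omega}}=M^{\underline{\omega}}+N^{\underline{\omega}}$; $(M\times N)^{\underline{\omega}}=\sum_{\underline{\omega}^1\underline{\omega}^2=\underline{\omega}}M^{\underline{\omega}^1}N^{\underline{\omega}^2}$ (sum over all factorizations by concatenation, empty factors allowed); and $$(M\circ N)^{\underline{\omega}}=\sum_{s\ge0}\ \sum_{\underline{\omega}^1\cdots\underline{\omega}^s=\underline{\omega},\ \underline{\omega}^i\neq\emptyset}M^{(\|\underline{\omega}^1\|,\dots,\|\underline{\omega}^s\|)}\,N^{\underline{\omega}^1}\cdots N^{\underline{\omega}^s}$$ (so that $(M\circ N)^\emptyset=M^\emptyset$). *)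

(* Defs.v *)
From HB Require Import structures.
From mathcomp Require Import all_boot all_algebra.
From mathcomp Require Import boolp functions.

Set Implicit Arguments.
Unset Strict Implicit.
Unset Printing Implicit Defensive.

Import GRing.Theory.
Local Open Scope ring_scope.

(* The alias keeps the mould product apart from the pointwise product that
   [functions] puts on function types. *)
Definition mould (Omega K : Type) : Type := seq Omega -> K.

(* All factorizations of a word into non-empty factors: the first letter either
   is a factor by itself or extends the first factor of the rest. *)
Fixpoint factorizations (T : Type) (w : seq T) : seq (seq (seq T)) :=
  if w is x :: w' then
    [seq [:: x] :: ws | ws <- factorizations w'] ++
    pmap (fun ws => if ws is u :: ws' then Some ((x :: u) :: ws') else None)
         (factorizations w')
  else [:: [::]].

Lemma mem_factorizations (T : eqType) (w : seq T) (ws : seq (seq T)) :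
  (ws \in factorizations w) = (flatten ws == w) && ([::] \notin ws).
Proof.
elim: w ws => [|x w IHw] ws /=.
  by case: ws => [|[|y u] ws] //; rewrite !inE /= andbF.
rewrite mem_cat; apply/idP/idP.
  case/orP=> [/mapP[vs + ->]|].
    by rewrite IHw => /andP[/eqP /= -> vs0]; rewrite inE eqxx.
  rewrite mem_pmap => /mapP[[|u vs] //].
  rewrite IHw inE negb_or /= => /andP[/eqP <- /andP[_ vs0]] [->] /=.
  by rewrite eqxx inE.
case: ws => [|[|y [|z u]] ws] //; rewrite inE /= ?andbF //.
- rewrite eqseq_cons => /andP[/andP[/eqP -> wsw] ws0].
  by apply/orP; left; rewrite map_f // IHw wsw.
- rewrite eqseq_cons => /andP[/andP[/eqP -> wsw] ws0].
  apply/orP; right; rewrite mem_pmap; apply/mapP.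
  by exists ((z :: u) :: ws) => //; rewrite IHw inE /= wsw.
Qed.

Lemma factorizations_uniq (T : eqType) (w : seq T) : uniq (factorizations w).
Proof.
elim: w => [|x w IHw] //=; rewrite cat_uniq map_inj_uniq ?IHw /=; last first.
  by move=> ? ? [].
apply/andP; split.
  apply/hasPn => ws; rewrite mem_pmap => /mapP[[|u vs] //].
  rewrite mem_factorizations inE negb_or => /andP[_ /andP[u0 _]] [->].
  by apply/mapP => -[? _ [u_nil _]]; rewrite u_nil eqxx in u0.
pose g vs := if vs is (_ :: u) :: vs' then u :: vs' else [::] : seq (seq T).
by apply: (@pmap_uniq _ _ _ g) => // -[].
Qed.

(* [None] on the empty word, whose norm is undefined: Omega has no zero. *)
Definition word_norm (Omega : baseAddMagmaType) (w : seq Omega) : option Omega :=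
  if w is x :: s then Some (foldl +%R x s) else None.

Section MouldOperations.
Variables (Omega : Type) (K : comPzRingType).
Implicit Types M N P : mould Omega K.

Definition mould_one : mould Omega K := fun w => (nilp w)%:R.

Definition mould_mul M N : mould Omega K := fun w =>
  \sum_(i < (size w).+1) M (take i w) * N (drop i w).

HB.instance Definition _ := GRing.Lmodule.copy (mould Omega K) (seq Omega -> K^o).

Let shift (x : Omega) M : mould Omega K := fun w => M (x :: w).

Let mul_nil M N : mould_mul M N [::] = M [::] * N [::].
Proof. by rewrite /mould_mul big_ord1. Qed.

Let mul_cons M N x w :
  mould_mul M N (x :: w) = M [::] * N (x :: w) + mould_mul (shift x M) N w.
Proof. by rewrite /mould_mul /= big_ord_recl. Qed.

Let mulDl : left_distributive mould_mul +%R.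
Proof.
move=> M N P; apply/funext => w.
transitivity (mould_mul M P w + mould_mul N P w) => //.
by rewrite /mould_mul -big_split; apply: eq_bigr => i _; exact: mulrDl.
Qed.

Let mulDr : right_distributive mould_mul +%R.
Proof.
move=> M N P; apply/funext => w.
transitivity (mould_mul M N w + mould_mul M P w) => //.
by rewrite /mould_mul -big_split; apply: eq_bigr => i _; exact: mulrDr.
Qed.

Let mulZl (a : K) M N : a *: mould_mul M N = mould_mul (a *: M) N.
Proof.
apply/funext => w; rewrite /mould_mul.
transitivity (a * \sum_(i < (size w).+1) M (take i w) * N (drop i w)) => //.
by rewrite mulr_sumr; apply: eq_bigr => i _; rewrite mulrA.
Qed.

Let mulA : associative mould_mul.
Proof.
move=> M N P; apply/funext => w.
elim: w M => [|x w IHw] M; first by rewrite !mul_nil mulrA.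
rewrite !mul_cons IHw mul_nil mulrDr -mulrA -addrA; congr (_ + _).
have -> : shift x (mould_mul M N) =
    M [::] *: shift x N + mould_mul (shift x M) N.
  by apply/funext => v; rewrite /shift mul_cons.
by rewrite mulDl -mulZl.
Qed.

Let mul1 : left_id mould_one mould_mul.
Proof.
move=> M; apply/funext => w; rewrite /mould_mul big_ord_recl take0 drop0 mul1r.
rewrite big1 ?addr0 // => i _; case: w i => [|x w] i; first by case: i.
by rewrite /mould_one mul0r.
Qed.

Let mulr1 : right_id mould_one mould_mul.
Proof.
move=> M; apply/funext => w; rewrite /mould_mul big_ord_recr /=.
rewrite take_size drop_size mulr1 big1 ?add0r // => i _.
by rewrite /mould_one /nilp size_drop subn_eq0 leqNgt ltn_ord mulr0.
Qed.

HB.instance Definition _ := GRing.Zmodule_isPzRing.Build (mould Omega K)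
  mulA mul1 mulr1 mulDl mulDr.

Lemma mould_addE M N w : (M + N) w = M w + N w.
Proof. by []. Qed.

Lemma mould_scaleE (a : K) M w : (a *: M) w = a * M w.
Proof. by []. Qed.

Lemma mould_oneE w : (1 : mould Omega K) w = (nilp w)%:R.
Proof. by []. Qed.

Lemma mould_mulE M N w :
  (M * N) w = \sum_(i < (size w).+1) M (take i w) * N (drop i w).
Proof. by []. Qed.

Lemma mould_scalerAl (a : K) M N : a *: (M * N) = (a *: M) * N.
Proof. exact: mulZl. Qed.

Lemma mould_scalerAr (a : K) M N : a *: (M * N) = M * (a *: N).
Proof.
apply/funext => w; rewrite mould_scaleE !mould_mulE mulr_sumr.
by apply: eq_bigr => i _; rewrite mulrCA.
Qed.

End MouldOperations.

(* The algebra structures of the library require a non-zero ring. *)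
Section MouldAlgebra.
Variables (Omega : Type) (K : comNzRingType).

Let oner_neq0 : (1 : mould Omega K) != 0.
Proof.
by apply/eqP => /(congr1 (fun M : mould Omega K => M [::])) /eqP;
  rewrite oner_eq0.
Qed.

HB.instance Definition _ :=
  GRing.PzSemiRing_isNonZero.Build (mould Omega K) oner_neq0.

HB.instance Definition _ := GRing.Lmodule_isLalgebra.Build K (mould Omega K)
  (@mould_scalerAl Omega K).

HB.instance Definition _ := GRing.Lalgebra_isAlgebra.Build K (mould Omega K)
  (@mould_scalerAr Omega K).

End MouldAlgebra.

(* [pmap] drops nothing: the factors in [ws] are non-empty, so each has a norm.
   The number s of factors is [size ws]. *)
Definition mould_comp (Omega : baseAddMagmaType) (K : comPzRingType)
    (M N : mould Omega K) : mould Omega K := fun w =>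
  \sum_(ws <- factorizations w)
    M (pmap (@word_norm Omega) ws) * \prod_(u <- ws) N u.

Lemma mould_comp_nil (Omega : baseAddMagmaType) (K : comPzRingType)
  (M N : mould Omega K) : mould_comp M N [::] = M [::].
Proof. by rewrite /mould_comp big_seq1 big_nil mulr1. Qed.

Declare Scope mould_scope.
Delimit Scope mould_scope with mould.
Notation "M \o N" := (mould_comp M N) : mould_scope.

(* Main.v *)
Require Import Defs.
From mathcomp Require Import all_boot all_algebra.
From mathcomp Require Import boolp.

Import GRing.Theory.

Local Open Scope ring_scope.
Local Open Scope mould_scope.

(** Composition on the right by [A] sums a weight over the factorizations of a
word into non-empty factors, and this weight is linear in the left mould, which
gives the compatibility with sums.

For products, [(M * N) \o A] at [w] sums over the factorizations of [w] that are
cut into two possibly empty runs of factors, because cutting the word of norms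
is the same as cutting the sequence of factors ([mould_mul_pmap]).  The first
run concatenates to a prefix of [w] and the second to the complementary suffix,
so such a datum is the same as a cut of [w] together with a factorization of
each half ([sum_cut_factorizations]).  As [K] is commutative, the weight of a
factorization, in which [\prod_(u <- ws) A u] is multiplicative, splits along
the cut, and the sum over the second kind of data is the value at [w] of
[(M \o A) * (N \o A)]. *)

Section Factorizations.
Variables (T : Type) (V : nmodType).

Lemma sum_factorizations_cons (x : T) (w : seq T) (H : seq (seq T) -> V) :
  \sum_(ws <- factorizations (x :: w)) H ws =
  \sum_(ws <- factorizations w)
    (H ([:: x] :: ws) + if ws is u :: ws' then H ((x :: u) :: ws') else 0).
Proof.
rewrite /= big_cat big_map big_split /=; congr (_ + _).
elim: (factorizations w) => [|[|u ws] s IHs] /=; rewrite ?big_nil //.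
  by rewrite big_cons add0r.
by rewrite !big_cons IHs.
Qed.

(** Non-emptiness of the factors is what gives each of them a norm.  Classical
logic makes equality of letters decidable, so that membership in the sequence of
factorizations makes sense over any alphabet. *)
Lemma eq_sum_factorizations (w : seq T) (G H : seq (seq T) -> V) :
  (forall ws, all (fun u => ~~ nilp u) ws -> G ws = H ws) ->
  \sum_(ws <- factorizations w) G ws = \sum_(ws <- factorizations w) H ws.
Proof.
move=> GH; apply: (@eq_big_seq _ _ _ (seq (seq {classic T}))) => ws.
rewrite mem_factorizations => /andP[_ ws0]; apply: GH.
by apply/(@allP (seq {classic T})) => -[|y u] // u_ws; rewrite u_ws in ws0.
Qed.

(** The summand has to be arbitrary for the induction on [w]: the cut in front
of the first letter [x] is split off on both sides, and in the remaining terms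
the left part [us] is non-empty, hence arises from a factorization of a prefix
of the tail by one of the two ways of adding [x], which the induction hypothesis
absorbs in the summand. *)
Lemma sum_cut_factorizations (w : seq T) (F : seq (seq T) -> seq (seq T) -> V) :
  \sum_(ws <- factorizations w)
    \sum_(j < (size ws).+1) F (take j ws) (drop j ws) =
  \sum_(i < (size w).+1) \sum_(us <- factorizations (take i w))
    \sum_(vs <- factorizations (drop i w)) F us vs.
Proof.
elim: w F => [|x w IHw] F; first by rewrite /= big_ord1 !big_seq1 big_ord1.
pose Fx us vs :=
  F ([:: x] :: us) vs + if us is u :: us' then F ((x :: u) :: us') vs else 0.
rewrite big_ord_recl take0 drop0 [X in X + _]big_seq1.
transitivity (\sum_(vs <- factorizations (x :: w)) F [::] vs +
    \sum_(i < (size w).+1) \sum_(us <- factorizations (take i w))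
      \sum_(vs <- factorizations (drop i w)) Fx us vs); last first.
  congr (_ + _); apply: eq_bigr => i _.
  rewrite [take _ _]/= sum_factorizations_cons; apply: eq_bigr => us _.
  by rewrite big_split; case: us => [|u us] /=; rewrite ?big1_eq.
rewrite -IHw !sum_factorizations_cons -big_split /=.
apply: eq_bigr => -[|u ws] _.
  by rewrite /Fx !big_ord_recl !big_ord0 /= !addr0.
rewrite /Fx big_split [X in _ = _ + (_ + X)]big_ord_recl /= add0r.
by rewrite [X in X + _ = _]big_ord_recl [X in _ + X = _]big_ord_recl addrACA.
Qed.

End Factorizations.

(** Since [f] is defined on all of [s], [pmap f] preserves positions, so cuts of
[pmap f s] are cuts of [s]. *)
Lemma mould_mul_pmap (S T : Type) (K : comPzRingType) (M N : mould T K)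
    (f : S -> option T) (s : seq S) : all f s ->
  (M * N) (pmap f s) =
  \sum_(j < (size s).+1) M (pmap f (take j s)) * N (pmap f (drop j s)).
Proof.
move=> fs; rewrite mould_mulE size_pmap.
have /eqP -> : count f s == size s by rewrite -all_count.
apply: eq_bigr => j _; move: (nat_of_ord j) => {j} k.
have [-> ->] // : take k (pmap f s) = pmap f (take k s) /\
  drop k (pmap f s) = pmap f (drop k s).
elim: s fs k => [|y s IHs] //= /andP[].
case fy: (f y) => [z|] //= _ /IHs{}IHs [|k] /=; rewrite ?fy //.
by have [-> ->] := IHs k.
Qed.

Theorem mainTheorem5 (Omega : baseAddMagmaType)
    (addA : associative (+%R : Omega -> Omega -> Omega))
    (K : comPzRingType) (M N A : mould Omega K) :
  (M + N) \o A = (M \o A) + (N \o A) /\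
  (M * N) \o A = (M \o A) * (N \o A).
Proof.
split; apply/funext => w.
  rewrite mould_addE /mould_comp -big_split.
  by apply: eq_bigr => ws _; rewrite mould_addE mulrDl.
pose weight (P : mould Omega K) ws :=
  P (pmap (@word_norm Omega) ws) * \prod_(u <- ws) A u.
transitivity (\sum_(ws <- factorizations w) \sum_(j < (size ws).+1)
    weight M (take j ws) * weight N (drop j ws)).
  apply: eq_sum_factorizations => ws ws0.
  rewrite mould_mul_pmap; last by apply: sub_all ws0 => -[].
  rewrite mulr_suml; apply: eq_bigr => j _.
  by rewrite -[X in bigop _ X](cat_take_drop j) big_cat mulrACA.
rewrite (sum_cut_factorizations _ _ _
  (fun us vs => weight M us * weight N vs)).
rewrite mould_mulE; apply: eq_bigr => i _.
by rewrite mulr_suml; apply: eq_bigr => us _; rewrite mulr_sumr.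
Qed.
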